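(* Let $V\xrightarrow{R}\mathfrak{g}$ be an rRB Leibniz algebra. Then there is a one-to-one correspondence between equivalence classes of infinitesimal deformations of $V\xrightarrow{R}\mathfrak{g}$ and the second cohomology group $H^2_\mathrm{rRB}(V\xrightarrow{R}\mathfrak{g})$ of $V\xrightarrow{R}\mathfrak{g}$ with coefficients in the adjoint representation.
   Context: All vector spaces and linear maps are over a field $\mathbf{k}$ of characteristic $0$. Leibniz algebra: a vector space $\mathfrak{g}$ with a linear map $[~,~]_\mathfrak{g}=\mu_\mathfrak{g}:\mathfrak{g}\otimes\mathfrak{g}\to\mathfrak{g}$ satisfying $[x,[y,z]_\mathfrak{g}]_\mathfrak{g}=[[x,y]_\mathfrak{g},z]_\mathfrak{g}+[y,[x,z]_\mathfrak{g}]_\mathfrak{g}$. A representation of $\mathfrak{g}$ is a vector space $V$ with linear maps $l_V:\mathfrak{g}\otimes V\to V$, $r_V:V\otimes\mathfrak{g}\to V$ such that $l_V(x,l_V(y,v))=l_V([x,y]_\mathfrak{g},v)+l_V(y,l_V(x,v))$; $l_V(x,r_V(v,y))=r_V(l_V(x,v),y)+r_V(v,[x,y]_\mathfrak{g})$; $r_V(v,[x,y]_\mathfrak{g})=r_V(r_V(v,x),y)+l_V(x,r_V(v,y))$. An rRB Leibniz algebra $V\xrightarrow{R}\mathfrak{g}$ consists of a Leibniz algebra $\mathfrak{g}$, a representation $(V,l_V,r_V)$ of it, and a relative Rota-Baxter operator, i.e. a linear map $R:V\to\mathfrak{g}$ with $[R(v),R(v')]_\mathfrak{g}=R(l_V(R(v),v')+r_V(v,R(v')))$.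 A morphism from $V\xrightarrow{R}\mathfrak{g}$ to $V'\xrightarrow{R'}\mathfrak{g}'$ is a pair $(\phi,\psi)$ of a Leibniz algebra morphism $\phi:\mathfrak{g}\to\mathfrak{g}'$ and a linear map $\psi:V\to V'$ with $\psi(l_V(x,v))=l_{V'}(\phi(x),\psi(v))$, $\psi(r_V(v,x))=r_{V'}(\psi(v),\phi(x))$, $\phi\circ R=R'\circ\psi$. The same definitions make sense over a commutative ring $\mathsf{R}$, with $\mathsf{R}$-modules and $\mathsf{R}$-linear maps. Infinitesimal deformations: let $\mathsf{R}=\mathbf{k}[[t]]/(t^2)$ with augmentation $\epsilon:\mathsf{R}\to\mathbf{k}$, $t\mapsto0$. An infinitesimal deformation of $V\xrightarrow{R}\mathfrak{g}$ is a quadruple $(\mu_t=\mu_\mathfrak{g}+t\mu_1,\ l_t=l_V+tl_1,\ r_t=r_V+tr_1,\ R_t=R+tR_1)$, with $\mu_1\in\mathrm{Hom}(\mathfrak{g}^{\otimes2},\mathfrak{g})$, $l_1\in\mathrm{Hom}(\mathfrak{g}\otimes V,V)$, $r_1\in\mathrm{Hom}(V\otimes\mathfrak{g},V)$, $R_1\in\mathrm{Hom}(V,\mathfrak{g})$, such that (extending $\mathsf{R}$-linearly) $(\mathsf{R}\otimes\mathfrak{g},\mu_t)$ is a Leibniz algebra over $\mathsf{R}$, $(\mathsf{R}\otimes V,l_t,r_t)$ is a representation of it, and $R_t:\mathsf{R}\otimes V\to\mathsf{R}\otimes\mathfrak{g}$ is a relative Rota-Baxter operator. Two infinitesimal deformations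 are equivalent if there is an isomorphism $(\Phi,\Psi)$ of rRB Leibniz algebras over $\mathsf{R}$ between them with $(\epsilon\otimes\mathrm{id}_\mathfrak{g})\circ\Phi=\epsilon\otimes\mathrm{id}_\mathfrak{g}$ and $(\epsilon\otimes\mathrm{id}_V)\circ\Psi=\epsilon\otimes\mathrm{id}_V$ (that is, $\Phi=\mathrm{id}_\mathfrak{g}+t\phi_1$, $\Psi=\mathrm{id}_V+t\psi_1$ with $\phi_1 \in \mathrm{Hom}(\mathfrak{g},\mathfrak{g})$, $\psi_1\in\mathrm{Hom}(V,V)$). Cohomology: let $\mathfrak{g}^{n-1,1}$ be the direct sum of all $n$-fold tensor products of $n-1$ copies of $\mathfrak{g}$ and one copy of $V$ in all orders. Put $C^0_\mathrm{rRB}=0$, $C^1_\mathrm{rRB}=\mathrm{Hom}(\mathfrak{g},\mathfrak{g})\oplus\mathrm{Hom}(V,V)$ and $C^n_\mathrm{rRB}=\mathrm{Hom}(\mathfrak{g}^{\otimes n},\mathfrak{g})\oplus\mathrm{Hom}(\mathfrak{g}^{n-1,1},V)\oplus\mathrm{Hom}(V^{\otimes n-1},\mathfrak{g})$ for $n\ge2$. The differential is $\delta_\mathrm{rRB}(\alpha,\beta,\gamma)=(\delta\alpha,\ \delta^\alpha\beta,\ \delta_V\gamma+h_R(\alpha,\beta))$ (with $\gamma=0$ when $n=1$), where the components are as follows. Write $x\cdot y$ for $[x,y]_\mathfrak{g}$ if $x,y\in\mathfrak{g}$, for $l_V(x,y)$ if $x\in\mathfrak{g},y\in V$, and for $r_V(x,y)$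 if $x\in V,y\in\mathfrak{g}$. For $c=\alpha$ and $x_1,\ldots,x_{n+1}\in\mathfrak{g}$ (giving $\delta\alpha$), and for $c=\alpha+\beta$ with exactly one of $x_1,\ldots,x_{n+1}$ in $V$ and the others in $\mathfrak{g}$ (giving $\delta^\alpha\beta$; here $c$ means $\alpha$ when all its arguments are in $\mathfrak{g}$ and $\beta$ when exactly one is in $V$), the value at $(x_1,\ldots,x_{n+1})$ is $$\sum_{i=1}^n(-1)^{i+1}x_i\cdot c(x_1,\ldots,\widehat{x_i},\ldots,x_{n+1})+(-1)^{n+1}c(x_1,\ldots,x_n)\cdot x_{n+1}+\sum_{1\le i<j\le n+1}(-1)^ic(x_1,\ldots,\widehat{x_i},\ldots,x_{j-1},x_i\cdot x_j,x_{j+1},\ldots,x_{n+1}).$$ For $\gamma\in\mathrm{Hom}(V^{\otimes n-1},\mathfrak{g})$, with $l_\triangleright(v,x)=[R(v),x]_\mathfrak{g}-R(r_V(v,x))$, $r_\triangleleft(x,v)=[x,R(v)]_\mathfrak{g}-R(l_V(x,v))$ and $[v,v']_R=l_V(R(v),v')+r_V(v,R(v'))$, $$(\delta_V\gamma)(v_1,\ldots,v_n)=\sum_{i=1}^{n-1}(-1)^{i+1}l_\triangleright(v_i,\gamma(v_1,\ldots,\widehat{v_i},\ldots,v_n))+(-1)^nr_\triangleleft(\gamma(v_1,\ldots,v_{n-1}),v_n)+\sum_{1\le i<j\le n}(-1)^i\gamma(v_1,\ldots,\widehat{v_i},\ldots,v_{j-1},[v_i,v_j]_R,v_{j+1},\ldots,v_n),$$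 and $$h_R(\alpha,\beta)(v_1,\ldots,v_n)=(-1)^n\Big\{\alpha(R(v_1),\ldots,R(v_n))-\sum_{i=1}^nR\big(\beta(R(v_1),\ldots,v_i,\ldots,R(v_n))\big)\Big\}.$$ Then $\delta_\mathrm{rRB}^2=0$, and $H^n_\mathrm{rRB}(V\xrightarrow{R}\mathfrak{g})$ is the $n$-th cohomology group of this complex. *)

(* Defs.v *)
From HB Require Import structures.
From mathcomp Require Import all_boot all_order all_algebra.
From mathcomp Require Import boolp classical_sets functions.
Set Implicit Arguments.
Unset Strict Implicit.
Unset Printing Implicit Defensive.
Import GRing.Theory.
Local Open Scope classical_set_scope.
Local Open Scope ring_scope.

(* Linear maps out of tensor products are encoded as multilinear maps. *)
Definition bilinear_map (K : comNzRingType) (U V W : lmodType K)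
    (f : U -> V -> W) : Prop :=
  (forall u, linear (f u)) /\ (forall v, linear (f ^~ v)).

Definition multilinear (K : comNzRingType) (U W : lmodType K) (n : nat)
    (f : ('I_n -> U) -> W) : Prop :=
  forall (x : 'I_n -> U) (i : 'I_n),
    linear (fun u => f (fun k => if k == i then u else x k)).

Section RelativeRotaBaxter.
Variable K : comNzRingType.

Definition leibniz_algebra (g : lmodType K) (mu : g -> g -> g) : Prop :=
  bilinear_map mu /\
  forall x y z, mu x (mu y z) = mu (mu x y) z + mu y (mu x z).

Definition leibniz_rep (g V : lmodType K) (mu : g -> g -> g)
    (l : g -> V -> V) (r : V -> g -> V) : Prop :=
  [/\ bilinear_map l, bilinear_map r,
      forall x y v, l x (l y v) = l (mu x y) v + l y (l x v),
      forall x v y, l x (r v y) = r (l x v) y + r v (mu x y)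
    & forall v x y, r v (mu x y) = r (r v x) y + l x (r v y)].

Definition relative_rota_baxter (g V : lmodType K) (mu : g -> g -> g)
    (l : g -> V -> V) (r : V -> g -> V) (R : V -> g) : Prop :=
  linear R /\
  forall v w, mu (R v) (R w) = R (l (R v) w + r v (R w)).

Record rRB_data (g V : lmodType K) := RRBData {
  brk : g -> g -> g;
  lact : g -> V -> V;
  ract : V -> g -> V;
  rop : V -> g }.

Definition rRB_leibniz (g V : lmodType K) (A : rRB_data g V) : Prop :=
  [/\ leibniz_algebra (brk A),
      leibniz_rep (brk A) (lact A) (ract A)
    & relative_rota_baxter (brk A) (lact A) (ract A) (rop A)].

Definition rRB_morphism (g V g' V' : lmodType K)
    (A : rRB_data g V) (B : rRB_data g' V')
    (phi : g -> g') (psi : V -> V') : Prop :=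
  (linear phi /\ linear psi) /\
  [/\ forall x y, phi (brk A x y) = brk B (phi x) (phi y),
      forall x v, psi (lact A x v) = lact B (phi x) (psi v),
      forall v x, psi (ract A v x) = ract B (psi v) (phi x)
    & forall v, phi (rop A v) = rop B (psi v)].

Definition rRB_isomorphism (g V g' V' : lmodType K)
    (A : rRB_data g V) (B : rRB_data g' V')
    (phi : g -> g') (psi : V -> V') : Prop :=
  [/\ rRB_morphism A B phi psi, bijective phi & bijective psi].

End RelativeRotaBaxter.

(* The ring k[[t]]/(t^2); the pair (a, b) stands for a + t b. *)
Definition dualnum (k : comNzRingType) : Type := (k * k)%type.

Section DualNumbers.
Variable k : comNzRingType.

HB.instance Definition _ := GRing.Zmodule.copy (dualnum k) (k * k)%type.

Definition dn_one : dualnum k := (1, 0).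
Definition dn_mul (a b : dualnum k) : dualnum k :=
  (a.1 * b.1, a.1 * b.2 + a.2 * b.1).

Lemma dn_mulA : associative dn_mul.
Proof.
case=> [a1 a2] [b1 b2] [c1 c2]; rewrite /dn_mul /=; congr pair.
  by rewrite mulrA.
by rewrite mulrDr mulrDl !mulrA addrA.
Qed.

Lemma dn_mulC : commutative dn_mul.
Proof.
case=> [a1 a2] [b1 b2]; rewrite /dn_mul /=; congr pair; first exact: mulrC.
by rewrite addrC mulrC (mulrC a1).
Qed.

Lemma dn_mul1 : left_id dn_one dn_mul.
Proof. by case=> [a1 a2]; rewrite /dn_mul /= !mul1r mul0r addr0. Qed.

Lemma dn_mulDl : left_distributive dn_mul +%R.
Proof.
case=> [a1 a2] [b1 b2] [c1 c2]; rewrite /dn_mul /=; congr pair.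
  exact: mulrDl.
by rewrite /= !mulrDl addrACA.
Qed.

Lemma dn_one_neq0 : dn_one != 0.
Proof. by apply/eqP => -[/eqP]; rewrite oner_eq0. Qed.

HB.instance Definition _ := GRing.Zmodule_isComNzRing.Build (dualnum k)
  dn_mulA dn_mulC dn_mul1 dn_mulDl dn_one_neq0.

End DualNumbers.

(* The base change k[[t]]/(t^2) (x) M; the pair (x, y) stands for
   1 (x) x + t (x) y, i.e. x + t y. *)
Definition dualmod (k : comNzRingType) (M : lmodType k) : Type := (M * M)%type.

Section DualModule.
Variables (k : comNzRingType) (M : lmodType k).

HB.instance Definition _ := GRing.Zmodule.copy (dualmod M) (M * M)%type.

Definition dm_scale (a : dualnum k) (x : dualmod M) : dualmod M :=
  (a.1 *: x.1, a.1 *: x.2 + a.2 *: x.1).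

Lemma dm_scaleA a b x : dm_scale a (dm_scale b x) = dm_scale (a * b) x.
Proof.
case: a b x => [a1 a2] [b1 b2] [x1 x2]; rewrite /dm_scale /=; congr pair.
  by rewrite scalerA.
by rewrite scalerDr scalerDl !scalerA addrA.
Qed.

Lemma dm_scale1 : left_id 1 dm_scale.
Proof. by case=> [x1 x2]; rewrite /dm_scale /= !scale1r scale0r addr0. Qed.

Lemma dm_scaleDr : right_distributive dm_scale +%R.
Proof.
case=> [a1 a2] [x1 x2] [y1 y2]; rewrite /dm_scale /=; congr pair.
  exact: scalerDr.
by rewrite /= !scalerDr addrACA.
Qed.

Lemma dm_scaleDl x : {morph dm_scale^~ x : a b / a + b}.
Proof.
case: x => [x1 x2] [a1 a2] [b1 b2]; rewrite /dm_scale /=; congr pair.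
  exact: scalerDl.
by rewrite /= !scalerDl addrACA.
Qed.

HB.instance Definition _ := GRing.Zmodule_isLmodule.Build (dualnum k)
  (dualmod M) dm_scaleA dm_scale1 dm_scaleDr dm_scaleDl.

(* epsilon (x) id_M, where epsilon is the augmentation t |-> 0 *)
Definition dm_aug (x : dualmod M) : M := x.1.

End DualModule.

(* The k[t]/(t^2)-(bi)linear extensions of f0 + t f1. *)
Definition dual_ext1 (k : comNzRingType) (U W : lmodType k) (f0 f1 : U -> W) :
    dualmod U -> dualmod W :=
  fun x => (f0 x.1, f0 x.2 + f1 x.1).

Definition dual_ext2 (k : comNzRingType) (U V W : lmodType k)
    (f0 f1 : U -> V -> W) : dualmod U -> dualmod V -> dualmod W :=
  fun x y => (f0 x.1 y.1, f0 x.1 y.2 + f0 x.2 y.1 + f1 x.1 y.1).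

Section Deformations.
Variables (k : fieldType) (g V : lmodType k) (A : rRB_data g V).

(* A + t B, where B collects the first order terms (mu_1, l_1, r_1, R_1) *)
Definition deform (B : rRB_data g V) : rRB_data (dualmod g) (dualmod V) :=
  RRBData (dual_ext2 (brk A) (brk B)) (dual_ext2 (lact A) (lact B))
          (dual_ext2 (ract A) (ract B)) (dual_ext1 (rop A) (rop B)).

Definition inf_deformation (B : rRB_data g V) : Prop :=
  [/\ bilinear_map (brk B), bilinear_map (lact B), bilinear_map (ract B),
      linear (rop B) & rRB_leibniz (deform B)].

Definition equiv_deformation (B B' : rRB_data g V) : Prop :=
  exists (Phi : dualmod g -> dualmod g) (Psi : dualmod V -> dualmod V),
    [/\ rRB_isomorphism (deform B) (deform B') Phi Psi,
        forall x, dm_aug (Phi x) = dm_aug x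
      & forall v, dm_aug (Psi v) = dm_aug v].

Definition deformation_class (B : rRB_data g V) : set (rRB_data g V) :=
  [set B' | inf_deformation B' /\ equiv_deformation B B'].

Definition deformation_classes : set (set (rRB_data g V)) :=
  deformation_class @` inf_deformation.

End Deformations.

(* The Loday-Pirashvili differential of an n-cochain f on an algebra (A, m)
   with values in M, with actions l and r.  Indices start at 0; `lift i` skips
   i, so `x \o lift i` is x with its i-th entry deleted. *)
Definition lp_diff (A : Type) (M : zmodType) (m : A -> A -> A)
    (l : A -> M -> M) (r : M -> A -> M) (n : nat) (f : ('I_n -> A) -> M)
    (x : 'I_n.+1 -> A) : M :=
  \sum_(i < n.+1 | (i < n)%N) (l (x i) (f (x \o lift i)) *~ (-1) ^+ i)
  + r (f (x \o lift ord_max)) (x ord_max) *~ (-1) ^+ n.+1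
  + \sum_(i < n.+1) \sum_(j < n.+1 | (i < j)%N)
      (f (fun p => if lift i p == j then m (x i) (x j) else x (lift i p))
         *~ (-1) ^+ i.+1).

Section Cohomology.
Variables (k : fieldType) (g V : lmodType k) (A : rRB_data g V).

(* Underlying (not yet multilinear) n-cochains (alpha, beta, gamma).
   The summand of Hom(g^{n-1,1}, V) with V in position i is the component
   beta i, with beta i v y the value at the element v of V inserted at position
   i among the elements y of g. *)
Definition precochain (n : nat) : zmodType :=
  ((('I_n -> g) -> g) * ('I_n -> V -> ('I_n.-1 -> g) -> V)
     * (('I_n.-1 -> V) -> g))%type.

Definition cochains (n : nat) : set (precochain n) :=
  if n is 0 then [set 0] else
  [set c | [/\ multilinear c.1.1,
               forall i, (forall v, multilinear (c.1.2 i v)) /\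
                         (forall y, linear (c.1.2 i ^~ y)),
               multilinear c.2
             & n = 1%N -> c.2 = 0]].

(* The product x . y on g (+) V *)
Definition sd_mul (p q : g * V) : g * V :=
  (brk A p.1 q.1, lact A p.1 q.2 + ract A p.2 q.1).

(* The multilinear extension of c = alpha + beta to g (+) V (zero when two or
   more arguments lie in V) *)
Definition sd_lift (n : nat) (alpha : ('I_n -> g) -> g)
    (beta : 'I_n -> V -> ('I_n.-1 -> g) -> V) (z : 'I_n -> g * V) : g * V :=
  (alpha (fun p => (z p).1),
   \sum_(i < n) beta i (z i).2 (fun p => (z (lift i p)).1)).

(* v inserted at position i among y *)
Definition sd_insert (n : nat) (i : 'I_n) (v : V) (y : 'I_n.-1 -> g) :
    'I_n -> g * V :=
  fun p => if unlift i p is Some q then (y q, 0) else (0, v).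

Definition d_alpha (n : nat) (alpha : ('I_n -> g) -> g) :
    ('I_n.+1 -> g) -> g :=
  lp_diff (brk A) (brk A) (brk A) alpha.

Definition d_beta (n : nat) (alpha : ('I_n -> g) -> g)
    (beta : 'I_n -> V -> ('I_n.-1 -> g) -> V) :
    'I_n.+1 -> V -> ('I_n -> g) -> V :=
  fun i v y => (lp_diff sd_mul sd_mul sd_mul (sd_lift alpha beta)
                  (sd_insert i v y)).2.

Definition l_tri (v : V) (x : g) : g :=
  brk A (rop A v) x - rop A (ract A v x).
Definition r_tri (x : g) (v : V) : g :=
  brk A x (rop A v) - rop A (lact A x v).
Definition brk_R (v w : V) : V :=
  lact A (rop A v) w + ract A v (rop A w).

Definition d_gamma (m : nat) (gamma : ('I_m -> V) -> g) : ('I_m.+1 -> V) -> g :=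
  lp_diff brk_R l_tri r_tri gamma.

Definition h_R (n : nat) (alpha : ('I_n -> g) -> g)
    (beta : 'I_n -> V -> ('I_n.-1 -> g) -> V) (v : 'I_n -> V) : g :=
  (alpha (fun p => rop A (v p))
   - \sum_(i < n) rop A (beta i (v i) (fun p => rop A (v (lift i p)))))
  *~ (-1) ^+ n.

Definition d_rRB (n : nat) : precochain n -> precochain n.+1 :=
  match n return precochain n -> precochain n.+1 with
  | 0 => fun=> 0
  | m.+1 => fun c =>
      (d_alpha c.1.1, d_beta c.1.1 c.1.2,
       fun v => d_gamma c.2 v + h_R c.1.1 c.1.2 v)
  end.

Definition cocycles (n : nat) : set (precochain n) :=
  [set c | cochains c /\ d_rRB c = 0].

Definition coboundaries (n : nat) : set (precochain n) :=
  match n return set (precochain n) with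
  | 0 => [set 0]
  | m.+1 => @d_rRB m @` @cochains m
  end.

Definition cohomology_class (n : nat) (c : precochain n) :
    set (precochain n) :=
  [set c + b | b in @coboundaries n].

(* H^n_rRB, as the set of cosets of the coboundaries in the cocycles *)
Definition cohomology (n : nat) : set (set (precochain n)) :=
  @cohomology_class n @` @cocycles n.

End Cohomology.

Arguments cochains {k} g V n.
Arguments cocycles {k g V} A n.
Arguments coboundaries {k g V} A n.
Arguments cohomology_class {k g V} A n c.
Arguments cohomology {k g V} A n.

(* (mu_1, l_1 + r_1, R_1) as a 2-cochain; r_1 is the component with V first *)
Definition deformation_cochain (k : fieldType) (g V : lmodType k)
    (B : rRB_data g V) : precochain g V 2 :=
  (fun x => brk B (x ord0) (x ord_max),
   fun i v y => if i == ord0 then ract B v (y ord0) else lact B (y ord0) v,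
   fun v => rop B (v ord0)).

(* Main.v *)
(* Over k[t]/(t^2) every structure equation has two components: the constant one
   is the corresponding equation for A, and the coefficient of t, modulo the
   former, says that (mu_1, l_1 + r_1, R_1) is killed by d_rRB.  Hence
   infinitesimal deformations are the same thing as 2-cocycles.  Likewise an
   equivalence is of the form (id + t phi, id + t psi) and is automatically
   invertible, with inverse (id - t phi, id - t psi); comparing coefficients of
   t, it intertwines two deformations iff their cochains differ by
   d_rRB (phi, psi). *)
Require Import Defs.
From mathcomp Require Import all_boot all_order all_algebra.
From mathcomp Require Import boolp classical_sets functions.
Set Implicit Arguments.
Unset Strict Implicit.
Unset Printing Implicit Defensive.
Import GRing.Theory.
Local Open Scope ring_scope.

(** * Elementary rules for linear and bilinear maps *)

Section Linearity.
Variables (K : comNzRingType) (U W : lmodType K).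
Implicit Types f : U -> W.

Lemma linear_fD f : linear f -> {morph f : x y / x + y}.
Proof. by move=> fL x y; have := fL 1 x y; rewrite !scale1r. Qed.

Lemma eq_linear f f' : linear f -> f =1 f' -> linear f'.
Proof. by move=> fL /funext <-. Qed.

Lemma linear_f0 f : linear f -> f 0 = 0.
Proof. by move=> fL; apply: (addrI (f 0)); rewrite -(linear_fD fL) !addr0. Qed.

Lemma linear_fZ f : linear f -> forall a, {morph f : x / a *: x}.
Proof. by move=> fL a x; have := fL a x 0; rewrite linear_f0 // !addr0. Qed.

Lemma linear_fB f : linear f -> {morph f : x y / x - y}.
Proof. by move=> fL x y; rewrite -!scaleN1r (linear_fD fL) (linear_fZ fL). Qed.

Lemma linear_add f f' : linear f -> linear f' -> linear (fun x => f x + f' x).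
Proof. by move=> fL f'L a x y; rewrite fL f'L scalerDr addrACA. Qed.

Lemma linear_sub f f' : linear f -> linear f' -> linear (fun x => f x - f' x).
Proof. by move=> fL f'L a x y; rewrite fL f'L scalerBr opprD addrACA. Qed.

End Linearity.

Section Bilinearity.
Variables (K : comNzRingType) (U V W : lmodType K) (h : U -> V -> W).

Lemma bilinear_Dl : bilinear_map h -> forall v, {morph h^~ v : x y / x + y}.
Proof. by case=> _ hL v; apply: linear_fD (hL v). Qed.

Lemma bilinear_Dr : bilinear_map h -> forall u, {morph h u : x y / x + y}.
Proof. by case=> hR _ u; apply: linear_fD (hR u). Qed.

Lemma bilinear_Bl : bilinear_map h -> forall v, {morph h^~ v : x y / x - y}.
Proof. by case=> _ hL v; apply: linear_fB (hL v). Qed.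

Lemma bilinear_Br : bilinear_map h -> forall u, {morph h u : x y / x - y}.
Proof. by case=> hR _ u; apply: linear_fB (hR u). Qed.

Lemma bilinear_0l : bilinear_map h -> forall v, h 0 v = 0.
Proof. by case=> _ hL v; apply: linear_f0 (hL v). Qed.

Lemma bilinear_0r : bilinear_map h -> forall u, h u 0 = 0.
Proof. by case=> hR _ u; apply: linear_f0 (hR u). Qed.

End Bilinearity.

(** * Equations over the dual numbers, compared by the coefficient of t *)

Section DualExtensions.
Variable k : comNzRingType.

Lemma dual_ext1_linear (U W : lmodType k) (f0 f1 : U -> W) :
  linear f0 -> linear f1 -> linear (dual_ext1 f0 f1).
Proof.
move=> L0 L1 a x y; rewrite /dual_ext1; congr pair => /=; first exact: L0.
rewrite !(linear_fD L0, linear_fD L1, linear_fZ L0, linear_fZ L1) scalerDr.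
rewrite -!addrA; congr (_ + _); rewrite [RHS]addrCA; congr (_ + _).
by rewrite addrCA.
Qed.

Lemma dual_ext2_bilinear (U V W : lmodType k) (f0 f1 : U -> V -> W) :
  bilinear_map f0 -> bilinear_map f1 -> bilinear_map (dual_ext2 f0 f1).
Proof.
move=> [R0 L0] [R1 L1]; split=> [u|v].
  rewrite (_ : dual_ext2 f0 f1 u =
      dual_ext1 (f0 u.1) (fun v => f0 u.2 v + f1 u.1 v)).
    by apply: dual_ext1_linear => //; apply: linear_add.
  by apply/funext => v; rewrite /dual_ext2 /dual_ext1 addrA.
rewrite (_ : (fun u => dual_ext2 f0 f1 u v) =
    dual_ext1 (f0^~ v.1) (fun u => f0 u v.2 + f1 u v.1)).
  by apply: dual_ext1_linear => //; apply: linear_add.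
by apply/funext => u; rewrite /dual_ext2 /dual_ext1 addrA (addrC (f0 u.2 _)).
Qed.

(* The Leibniz identity and the three axioms of a representation are all of the
   form [p x (q y z) = r (s x y) z + t y (u x z)]. *)
Lemma dual_leibniz_identity (X Y Z P S T W : lmodType k)
    (p0 p1 : X -> P -> W) (q0 q1 : Y -> Z -> P) (r0 r1 : S -> Z -> W)
    (s0 s1 : X -> Y -> S) (t0 t1 : Y -> T -> W) (u0 u1 : X -> Z -> T) :
  bilinear_map p0 -> bilinear_map q0 -> bilinear_map r0 ->
  bilinear_map s0 -> bilinear_map t0 -> bilinear_map u0 ->
  bilinear_map p1 -> bilinear_map q1 -> bilinear_map r1 ->
  bilinear_map s1 -> bilinear_map t1 -> bilinear_map u1 ->
  (forall x y z, p0 x (q0 y z) = r0 (s0 x y) z + t0 y (u0 x z)) ->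
  (forall x y z, dual_ext2 p0 p1 x (dual_ext2 q0 q1 y z) =
     dual_ext2 r0 r1 (dual_ext2 s0 s1 x y) z +
     dual_ext2 t0 t1 y (dual_ext2 u0 u1 x z)) <->
  (forall x y z, p0 x (q1 y z) + p1 x (q0 y z) =
     r0 (s1 x y) z + r1 (s0 x y) z + (t0 y (u1 x z) + t1 y (u0 x z))).
Proof.
move=> p0B q0B r0B s0B t0B u0B p1B q1B r1B s1B t1B u1B id0.
split=> [id_t x y z | id1 x y z].
  (* On arguments without t-part, only the terms containing a first-order map survive in the
     coefficient of t. *)
  have /(congr1 snd) /= := id_t (x, 0) (y, 0) (z, 0).
  rewrite ?(bilinear_0l p0B, bilinear_0r q0B, bilinear_0l q0B, bilinear_0r r0B,
    bilinear_0r s0B, bilinear_0l s0B, bilinear_0l t0B, bilinear_0r u0B,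
    bilinear_0l u0B).
  by rewrite ?(add0r, addr0).
congr pair => /=; first exact: id0.
(* For general arguments the coefficient of t is [id1] at the constant parts plus three instances of
   [id0], each with one argument replaced by its t-part. *)
rewrite !(bilinear_Dr p0B, bilinear_Dl r0B, bilinear_Dr t0B) !id0.
rewrite [LHS](AC (2*2*1*2*1) ((1*2*3*4*6*7)*(5*8))) /= id1.
by rewrite [RHS](AC (1*3*1*5) ((1*6*2*9*3*7)*((4*5)*(8*10)))).
Qed.

(** This is the product rule: each term of the linearised equation carries exactly one of [m1],
    [l1], [r1], [R1], while the t-parts of [v] and [w] only contribute instances of the equation at
    t = 0. *)
Lemma dual_rota_baxter_identity (V g : lmodType k) (m0 m1 : g -> g -> g)
    (l0 l1 : g -> V -> V) (r0 r1 : V -> g -> V) (R0 R1 : V -> g) :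
  bilinear_map m0 -> bilinear_map l0 -> bilinear_map r0 -> linear R0 ->
  bilinear_map m1 -> bilinear_map l1 -> bilinear_map r1 -> linear R1 ->
  (forall v w, m0 (R0 v) (R0 w) = R0 (l0 (R0 v) w + r0 v (R0 w))) ->
  (forall v w, dual_ext2 m0 m1 (dual_ext1 R0 R1 v) (dual_ext1 R0 R1 w) =
     dual_ext1 R0 R1 (dual_ext2 l0 l1 (dual_ext1 R0 R1 v) w
                      + dual_ext2 r0 r1 v (dual_ext1 R0 R1 w))) <->
  (forall v w, m0 (R0 v) (R1 w) + m0 (R1 v) (R0 w) + m1 (R0 v) (R0 w) =
     R0 (l0 (R1 v) w + l1 (R0 v) w + (r0 v (R1 w) + r1 v (R0 w)))
     + R1 (l0 (R0 v) w + r0 v (R0 w))).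
Proof.
move=> m0B l0B r0B R0L m1B l1B r1B R1L id0.
split=> [id_t v w | id1 v w].
  have /(congr1 snd) /= := id_t (v, 0) (w, 0).
  rewrite ?(linear_f0 R0L, bilinear_0r l0B, bilinear_0l r0B).
  by rewrite ?(add0r, addr0).
congr pair => /=; first exact: id0.
rewrite !(bilinear_Dr m0B, bilinear_Dl m0B, bilinear_Dl l0B, bilinear_Dr r0B).
rewrite [LHS](AC (2*2*1) ((1*3)*(2*4*5))) /= id1 !id0.
rewrite -!(linear_fD R0L) addrA -!(linear_fD R0L); congr (R0 _ + _).
by rewrite [RHS](AC (1*2*1*4) ((1*5*(2*7))*((3*4)*(6*8)))).
Qed.

(** Solving the coefficient of t for [f1] exhibits the difference of the two first-order terms as a
    coboundary. Three independent spaces are allowed so that the bracket and both actions are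
    covered at once. *)
Lemma dual_morphism2 (X Y Z : lmodType k) (f f1 f1' : X -> Y -> Z)
    (phi : X -> X) (psi : Y -> Y) (chi : Z -> Z) :
  bilinear_map f ->
  (forall x y, dual_ext1 id chi (dual_ext2 f f1 x y) =
     dual_ext2 f f1' (dual_ext1 id phi x) (dual_ext1 id psi y)) <->
  (forall x y,
     f1 x y = f1' x y + (f x (psi y) + f (phi x) y - chi (f x y))).
Proof.
move=> fB; split=> [mor x y | eq1 x y].
  have /(congr1 snd) /= := mor (x, 0) (y, 0).
  rewrite !(bilinear_0l fB, bilinear_0r fB) !add0r => eq_xy.
  by rewrite addrA (addrC (f1' x y)) -eq_xy addrK.
congr pair => /=; rewrite eq1 (bilinear_Dl fB) (bilinear_Dr fB) -!addrA.
rewrite addNr addr0; congr (_ + _).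
by rewrite [LHS](AC (1*(1*2)) (3*(1*(4*2)))).
Qed.

Lemma dual_morphism1 (X Z : lmodType k) (f f1 f1' : X -> Z)
    (phi : X -> X) (chi : Z -> Z) :
  linear f ->
  (forall x, dual_ext1 id chi (dual_ext1 f f1 x) =
     dual_ext1 f f1' (dual_ext1 id phi x)) <->
  (forall x, f1 x = f1' x + (f (phi x) - chi (f x))).
Proof.
move=> fL; split=> [mor x | eq1 x].
  have /(congr1 snd) /= := mor (x, 0).
  rewrite (linear_f0 fL) !add0r => eq_x.
  by rewrite addrA (addrC (f1' x)) -eq_x addrK.
congr pair => /=; rewrite eq1 (linear_fD fL) -!addrA addNr addr0.
by rewrite (addrC (f1' _)).
Qed.

Lemma dual_ext1_id_bij (M : lmodType k) (phi : M -> M) :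
  linear phi -> bijective (dual_ext1 id phi).
Proof.
move=> phiL; exists (dual_ext1 id (fun x => - phi x)) => -[x y];
  by rewrite /dual_ext1 /= ?addrK ?subrK.
Qed.

(* Scaling by t = (0, 1) gives Phi (x + t y) = Phi x + t Phi y, so Phi is
   determined by its values on M. *)
Lemma dual_endo_expand (M : lmodType k) (Phi : dualmod M -> dualmod M) :
  linear Phi -> (forall x, dm_aug (Phi x) = dm_aug x) ->
  exists2 phi, linear phi & Phi = dual_ext1 id phi.
Proof.
move=> PhiL Phi_aug; exists (fun x => (Phi (x, 0)).2) => [a x y|].
  have /(congr1 snd) := PhiL ((a, 0) : dualnum k) (x, 0) (y, 0).
  rewrite [in RHS]/= scale0r addr0 => <-; congr (snd (Phi _)).
  by congr pair => /=; rewrite scaler0 scale0r !addr0.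
apply/funext => -[x y].
have -> : (x, y) = ((0, 1) : dualnum k) *: ((y, 0) : dualmod M) + (x, 0).
  by congr pair => /=; rewrite ?scale0r ?scale1r ?scaler0 ?add0r ?addr0.
rewrite PhiL.
have aug0 z : (Phi (z, 0)).1 = z := Phi_aug (z, 0).
by congr pair => /=; rewrite ?aug0 ?scale0r ?scale1r ?scaler0 ?add0r ?addr0.
Qed.

End DualExtensions.

(** * The Loday-Pirashvili differential in degrees 0, 1 and 2 *)

Section LowDegreeDifferentials.
Variables (A : Type) (M : zmodType) (m : A -> A -> A).
Variables (l : A -> M -> M) (r : M -> A -> M).

(** For concrete [n] the guard on the peeled index computes, so the filtered sums of [lp_diff]
    unfold completely. *)
Lemma sum_ord_recl (n : nat) (P : pred 'I_n.+1) (F : 'I_n.+1 -> M) :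
  \sum_(i < n.+1 | P i) F i =
  (if P ord0 then F ord0 else 0)
  + \sum_(i < n | P (lift ord0 i)) F (lift ord0 i).
Proof. by rewrite big_mkcond big_ord_recl -big_mkcond. Qed.

Lemma lp_diff0 (f : ('I_0 -> A) -> M) (c : M) (x : 'I_1 -> A) :
  (forall y, f y = c) -> lp_diff m l r f x = - r c (x ord0).
Proof.
move=> fE; rewrite /lp_diff !(sum_ord_recl, big_ord0) /= !fE !addr0 add0r.
by rewrite (_ : ord_max = ord0) //; apply: val_inj.
Qed.

Lemma lp_diff1 (f : ('I_1 -> A) -> M) (F : A -> M) (x : 'I_2 -> A) :
  (forall y, f y = F (y ord0)) ->
  lp_diff m l r f x = l (x ord0) (F (x ord_max)) + r (F (x ord0)) (x ord_max)
                      - F (m (x ord0) (x ord_max)).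
Proof.
move=> fE; rewrite /lp_diff !(sum_ord_recl, big_ord0) /= !fE -!val_eqE /=.
have -> : lift ord0 ord0 = ord_max :> 'I_2 by exact: val_inj.
have -> : lift ord_max ord0 = ord0 :> 'I_2 by exact: val_inj.
by rewrite !(add0r, addr0).
Qed.

Lemma lp_diff2 (f : ('I_2 -> A) -> M) (F : A -> A -> M) (x : 'I_3 -> A) :
  (forall y, f y = F (y ord0) (y ord_max)) ->
  let x0 := x ord0 in let x1 := x (lift ord0 ord0) in let x2 := x ord_max in
  lp_diff m l r f x = l x0 (F x1 x2) - l x1 (F x0 x2) - r (F x0 x1) x2
                      - F (m x0 x1) x2 - F x1 (m x0 x2) + F x0 (m x1 x2).
Proof.
move=> fE /=; rewrite /lp_diff !(sum_ord_recl, big_ord0) /= !fE -!val_eqE /=.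
have -> : lift ord0 ord_max = ord_max :> 'I_3 by exact: val_inj.
have -> : lift (lift ord0 ord0) ord0 = ord0 :> 'I_3 by exact: val_inj.
have -> : lift (lift ord0 ord0) ord_max = ord_max :> 'I_3 by exact: val_inj.
have -> : lift ord_max ord0 = ord0 :> 'I_3 by exact: val_inj.
have -> : lift ord_max ord_max = lift ord0 ord0 :> 'I_3 by exact: val_inj.
have -> : lift ord0 (lift ord0 ord0) = ord_max :> 'I_3 by exact: val_inj.
by rewrite !(add0r, addr0) !addrA.
Qed.

End LowDegreeDifferentials.

(** * Cochains of degree 1 and 2 as pairs and quadruples of maps *)

Section LowDegreeCochains.
Variables (k : fieldType) (g V : lmodType k).

Lemma ord2_cases (i : 'I_2) : i = ord0 \/ i = ord_max.
Proof. by case: i => [[|[]]] // i2; [left | right]; apply: val_inj. Qed.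

Lemma ord3_cases (i : 'I_3) : [\/ i = ord0, i = lift ord0 ord0 | i = ord_max].
Proof.
by case: i => [[|[|[]]]] // i3; [apply: Or31 | apply: Or32 | apply: Or33];
  apply: val_inj.
Qed.

Lemma lift_ord0_ord0 : lift ord0 ord0 = ord_max :> 'I_2.
Proof. exact: val_inj. Qed.

Lemma lift_ord_max_ord0 : lift ord_max ord0 = ord0 :> 'I_2.
Proof. exact: val_inj. Qed.

Lemma sd_insert_at n (i : 'I_n) (v : V) (y : 'I_n.-1 -> g) :
  sd_insert i v y i = (0, v).
Proof. by rewrite /sd_insert unlift_none. Qed.

Lemma sd_insert_lift n (i : 'I_n) (v : V) (y : 'I_n.-1 -> g) q :
  sd_insert i v y (lift i q) = (y q, 0).
Proof. by rewrite /sd_insert liftK. Qed.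

(** Through this the V-component of the differential becomes an instance of [lp_diff2] with
    [F := sd_mul B]. *)
Lemma sd_lift_deformation (B : rRB_data g V) (z : 'I_2 -> g * V) :
  sd_lift (deformation_cochain B).1.1 (deformation_cochain B).1.2 z
  = sd_mul B (z ord0) (z ord_max).
Proof.
rewrite /sd_lift /sd_mul /= !big_ord_recl big_ord0 /=.
by rewrite lift_ord0_ord0 lift_ord_max_ord0 addr0 addrC.
Qed.

(** The last component vanishes because C^1 has no third summand. *)
Definition linear_cochain (phi : g -> g) (psi : V -> V) : precochain g V 1 :=
  (fun x => phi (x ord0), fun _ v _ => psi v, 0).

Lemma sd_lift_linear phi psi (z : 'I_1 -> g * V) :
  sd_lift (linear_cochain phi psi).1.1 (linear_cochain phi psi).1.2 z
  = (phi (z ord0).1, psi (z ord0).2).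
Proof. by rewrite /sd_lift /= big_ord_recl big_ord0 addr0. Qed.

Definition bilinear_data (B : rRB_data g V) : Prop :=
  [/\ bilinear_map (brk B), bilinear_map (lact B), bilinear_map (ract B)
    & linear (rop B)].

Lemma deformation_cochain_multilinear (B : rRB_data g V) :
  bilinear_data B -> cochains g V 2 (deformation_cochain B).
Proof.
case=> brkB lB rB RL; split=> //=.
- move=> x i; case: (ord2_cases i) => ->; [exact: brkB.2 | exact: brkB.1].
- move=> i; case: (ord2_cases i) => -> /=; split=> [v x j | y].
  + by rewrite (ord1 j); apply: rB.1.
  + exact: rB.2.
  + by rewrite (ord1 j); apply: lB.2.
  + exact: lB.1.
- by move=> x j; rewrite (ord1 j).
Qed.

Lemma cochains2_deformation (c : precochain g V 2) : cochains g V 2 c ->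
  exists2 B, bilinear_data B & c = deformation_cochain B.
Proof.
case: c => [[alpha beta] gamma] [/= alphaM betaM gammaM _].
pose pair_fun (x y : g) (i : 'I_2) := if i == ord0 then x else y.
(* V in the last position gives the left action and V in the first position the right action; the
   one remaining argument from g is a constant family. *)
exists (RRBData (fun x y => alpha (pair_fun x y))
  (fun x v => beta ord_max v (fun=> x)) (fun v x => beta ord0 v (fun=> x))
  (fun v => gamma (fun=> v))).
  split=> /=.
  - split=> [x|y].
      (* The [0] is a placeholder: [multilinear] overwrites that slot by the varying argument. *)
      apply: eq_linear (alphaM (pair_fun x 0) ord_max) _ => y;
        congr alpha; apply/funext => i.
      by case: (ord2_cases i) => ->.
    apply: eq_linear (alphaM (pair_fun 0 y) ord0) _ => x;
      congr alpha; apply/funext => i.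
    by case: (ord2_cases i) => ->.
  - split=> [x | v]; first exact: (betaM ord_max).2.
    apply: eq_linear ((betaM ord_max).1 v (fun=> 0) ord0) _ => x;
      congr (beta _ v); apply/funext => j.
    by rewrite (ord1 j).
  - split=> [v | x]; last exact: (betaM ord0).2.
    apply: eq_linear ((betaM ord0).1 v (fun=> 0) ord0) _ => x;
      congr (beta _ v); apply/funext => j.
    by rewrite (ord1 j).
  - apply: eq_linear (gammaM (fun=> 0) ord0) _ => v;
      congr gamma; apply/funext => j.
    by rewrite (ord1 j).
congr (_, _, _).
- apply/funext => x; congr alpha; apply/funext => i.
  by case: (ord2_cases i) => ->.
- apply/funext => i; apply/funext => v; apply/funext => y.
  have -> : y = fun=> y ord0 by apply/funext => j; rewrite (ord1 j).
  by case: (ord2_cases i) => ->.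
- by apply/funext => v; congr gamma; apply/funext => j; rewrite (ord1 j).
Qed.

Lemma linear_cochain_multilinear phi psi :
  linear phi -> linear psi -> cochains g V 1 (linear_cochain phi psi).
Proof.
move=> phiL psiL; split=> //=.
- by move=> x j; rewrite (ord1 j).
(* Besides [v] there are no further arguments, so multilinearity in them is vacuous. *)
- by move=> i; split=> // v x [].
- by move=> x [].
Qed.

Lemma cochains1_linear (c : precochain g V 1) : cochains g V 1 c ->
  exists phi psi, [/\ linear phi, linear psi & c = linear_cochain phi psi].
Proof.
case: c => [[alpha beta] gamma] [/= alphaM betaM _ gamma0].
exists (fun x => alpha (fun=> x)), (beta ord0 ^~ (fun=> 0)); split.
- apply: eq_linear (alphaM (fun=> 0) ord0) _ => x;
    congr alpha; apply/funext => j.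
  by rewrite (ord1 j).
- exact: (betaM ord0).2.
- rewrite gamma0 //; congr (_, _, _).
    by apply/funext => x; congr alpha; apply/funext => j; rewrite (ord1 j).
  apply/funext => i; apply/funext => v; apply/funext => y; rewrite (ord1 i).
  by congr beta; apply/funext => -[].
Qed.

End LowDegreeCochains.

(** * The differential in low degrees, and deformations as 2-cocycles *)

Section SecondCohomology.
Variables (k : fieldType) (g V : lmodType k) (A : rRB_data g V).
Hypothesis A_rRB : rRB_leibniz A.

Let brkA : bilinear_map (brk A). Proof. by case: A_rRB => [[]]. Qed.
Let lactA : bilinear_map (lact A). Proof. by case: A_rRB => _ []. Qed.
Let ractA : bilinear_map (ract A). Proof. by case: A_rRB => _ []. Qed.
Let ropA : linear (rop A). Proof. by case: A_rRB => _ _ []. Qed.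

(** The differential of (phi, psi) as first-order terms: the defects of the pair as a derivation of
    the bracket and the actions, and its failure to commute with R. *)
Definition coboundary_data (phi : g -> g) (psi : V -> V) : rRB_data g V :=
  RRBData (fun x y => brk A x (phi y) + brk A (phi x) y - phi (brk A x y))
    (fun x v => lact A x (psi v) + lact A (phi x) v - psi (lact A x v))
    (fun v x => ract A v (phi x) + ract A (psi v) x - psi (ract A v x))
    (fun v => rop A (psi v) - phi (rop A v)).

Let zeros := (bilinear_0l brkA, bilinear_0r brkA, bilinear_0l lactA,
  bilinear_0r lactA, bilinear_0l ractA, bilinear_0r ractA, linear_f0 ropA).

Lemma d_rRB_linear_cochain phi psi : linear phi -> linear psi ->
  d_rRB A (linear_cochain phi psi)
  = deformation_cochain (coboundary_data phi psi).
Proof.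
move=> phiL psiL; congr (_, _, _).
- apply/funext => x; rewrite /d_alpha.
  by rewrite (lp_diff1 _ _ _ _ (F := phi)).
- apply/funext => i; apply/funext => v; apply/funext => y; rewrite /d_beta.
  rewrite (lp_diff1 _ _ _ _ (F := fun p => (phi p.1, psi p.2))); last first.
    exact: sd_lift_linear.
  case: (ord2_cases i) => -> /=.
    rewrite sd_insert_at -lift_ord0_ord0 sd_insert_lift /=.
    by rewrite !(zeros, linear_f0 phiL, linear_f0 psiL) !(add0r, addr0).
  rewrite sd_insert_at -lift_ord_max_ord0 sd_insert_lift /=.
  by rewrite !(zeros, linear_f0 phiL, linear_f0 psiL) !(add0r, addr0).
(* With gamma = 0 only [h_R] remains, and its sign (-1)^1 reverses the difference. *)
- apply/funext => v; rewrite /d_gamma (lp_diff0 _ _ _ _ (c := 0)) //.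
  rewrite /r_tri !zeros subr0 oppr0 add0r /h_R /= big_ord_recl big_ord0 addr0.
  by rewrite expr1 mulrN1z opprB.
Qed.

(** Moving the four negative terms of a degree 2 differential to the right gives the equation found
    in [dual_leibniz_identity]. *)
Lemma cocycle_identity (M : zmodType) (a b c d e f : M) :
  a - b - c - d - e + f = 0 <-> a + f = c + d + (b + e).
Proof.
rewrite (_ : a - b - c - d - e + f = a + f - (c + d + (b + e))).
  by split=> [/eqP|->]; rewrite ?subrr // subr_eq0 => /eqP.
rewrite !opprD.
by rewrite [LHS](AC 6 ((1*6)*((3*4)*(2*5)))).
Qed.

Lemma d_alpha_deformation (B : rRB_data g V) (x : 'I_3 -> g) :
  let x0 := x ord0 in let x1 := x (lift ord0 ord0) in let x2 := x ord_max in
  d_alpha A (deformation_cochain B).1.1 x =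
    brk A x0 (brk B x1 x2) - brk A x1 (brk B x0 x2) - brk A (brk B x0 x1) x2
    - brk B (brk A x0 x1) x2 - brk B x1 (brk A x0 x2) + brk B x0 (brk A x1 x2).
Proof. by rewrite /d_alpha (lp_diff2 _ _ _ _ (F := brk B)). Qed.

(** The three positions of [v] correspond to the three axioms of a representation, in reverse order:
    first position to the last axiom. *)
Lemma d_beta_deformation (B : rRB_data g V) (v : V) (y : 'I_2 -> g) :
  bilinear_data B ->
  let d i := d_beta A (deformation_cochain B).1.1 (deformation_cochain B).1.2
               i v y in
  let x0 := y ord0 in let x1 := y ord_max in
  [/\ d ord0 = ract A v (brk B x0 x1) - lact A x0 (ract B v x1)
        - ract A (ract B v x0) x1 - ract B (ract A v x0) x1
        - lact B x0 (ract A v x1) + ract B v (brk A x0 x1),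
      d (lift ord0 ord0) = lact A x0 (ract B v x1) - ract A v (brk B x0 x1)
        - ract A (lact B x0 v) x1 - ract B (lact A x0 v) x1
        - ract B v (brk A x0 x1) + lact B x0 (ract A v x1)
    & d ord_max = lact A x0 (lact B x1 v) - lact A x1 (lact B x0 v)
        - lact A (brk B x0 x1) v - lact B (brk A x0 x1) v
        - lact B x1 (lact A x0 v) + lact B x0 (lact A x1 v)].
Proof.
case=> brkB lactB ractB _ d x0 x1.
pose zerosB := (bilinear_0l brkB, bilinear_0r brkB, bilinear_0l lactB,
  bilinear_0r lactB, bilinear_0l ractB, bilinear_0r ractB).
have dE i : d i = _ :=
  congr1 snd (lp_diff2 _ _ _ (sd_insert i v y) (@sd_lift_deformation _ _ _ B)).
have insE (i p : 'I_3) (q : 'I_2) :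
    nat_of_ord (lift i q) = p -> sd_insert i v y p = (y q, 0).
  move=> lift_q; rewrite -(sd_insert_lift i v y); congr sd_insert.
  exact: val_inj.
split; rewrite dE sd_insert_at.
- rewrite (insE _ _ ord0) // (insE _ _ ord_max) //=.
  by rewrite !(zeros, zerosB) !(add0r, addr0).
- rewrite (insE _ ord0 ord0) // (insE _ ord_max ord_max) //=.
  by rewrite !(zeros, zerosB) !(add0r, addr0).
- rewrite (insE _ _ ord0) // (insE _ _ ord_max) //=.
  by rewrite !(zeros, zerosB) !(add0r, addr0).
Qed.

(** The correction terms of [l_tri] and [r_tri] join the R-terms of [h_R] under one [rop A], and
    [brk_R] supplies the argument of [rop B]: together, left minus right side of the linearised
    Rota-Baxter equation. *)
Lemma d_gamma_h_R_deformation (B : rRB_data g V) (v : 'I_2 -> V) :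
  linear (rop B) ->
  let v0 := v ord0 in let v1 := v ord_max in
  d_gamma A (deformation_cochain B).2 v
    + h_R A (deformation_cochain B).1.1 (deformation_cochain B).1.2 v =
  brk A (rop A v0) (rop B v1) + brk A (rop B v0) (rop A v1)
    + brk B (rop A v0) (rop A v1)
  - (rop A (lact A (rop B v0) v1 + lact B (rop A v0) v1
            + (ract A v0 (rop B v1) + ract B v0 (rop A v1)))
     + rop B (lact A (rop A v0) v1 + ract A v0 (rop A v1))).
Proof.
move=> ropB v0 v1; rewrite /d_gamma (lp_diff1 _ _ _ _ (F := rop B)) //.
rewrite /h_R /= !big_ord_recl big_ord0 /= lift_ord0_ord0 lift_ord_max_ord0.
rewrite addr0 /l_tri /r_tri /brk_R !(linear_fD ropA) !opprD -/v0 -/v1.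
rewrite [(-1) ^+ 2](_ : _ = 1) // mulr1z.
by rewrite !addrA [LHS](ACl (1*3*6*4*8*2*7*5)).
Qed.

Lemma d_rRB_deformation_eq0 (B : rRB_data g V) : bilinear_data B ->
  d_rRB A (deformation_cochain B) = 0 <->
  [/\ forall x y z, brk A x (brk B y z) + brk B x (brk A y z) =
        brk A (brk B x y) z + brk B (brk A x y) z
        + (brk A y (brk B x z) + brk B y (brk A x z)),
      forall x y v, lact A x (lact B y v) + lact B x (lact A y v) =
        lact A (brk B x y) v + lact B (brk A x y) v
        + (lact A y (lact B x v) + lact B y (lact A x v)),
      forall x v y, lact A x (ract B v y) + lact B x (ract A v y) =
        ract A (lact B x v) y + ract B (lact A x v) y
        + (ract A v (brk B x y) + ract B v (brk A x y)),
      forall v x y, ract A v (brk B x y) + ract B v (brk A x y) =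
        ract A (ract B v x) y + ract B (ract A v x) y
        + (lact A x (ract B v y) + lact B x (ract A v y))
    & forall v w, brk A (rop A v) (rop B w) + brk A (rop B v) (rop A w)
        + brk B (rop A v) (rop A w) =
        rop A (lact A (rop B v) w + lact B (rop A v) w
               + (ract A v (rop B w) + ract B v (rop A w)))
        + rop B (lact A (rop A v) w + ract A v (rop A w))].
Proof.
move=> B_lin; have [_ _ _ ropB] := B_lin.
have d_alphaE := d_alpha_deformation B.
have d_betaE v y := d_beta_deformation v y B_lin.
have d_gammaE v := d_gamma_h_R_deformation v ropB.
pose two (T : Type) (x y : T) (i : 'I_2) := if i == ord0 then x else y.
split=> [|[mu1 ll1 lr1 rr1 rop1]].
  move=> d0; have /(congr1 (fun c => c.1.1)) /= d_alpha0 := d0.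
  have /(congr1 (fun c => c.1.2)) /= d_beta0 := d0.
  have /(congr1 snd) /= d_gamma0 := d0.
  split=> [x y z | x y v | x v y | v x y | v w].
  - apply/cocycle_identity.
    pose xyz (i : 'I_3) :=
      if i == ord0 then x else if i == ord_max then z else y.
    exact: etrans (esym (d_alphaE xyz)) (congr1 (@^~ xyz) d_alpha0).
  - apply/cocycle_identity.
    (* The position chosen for [v] selects the axiom: last here, then middle, then first. *)
    have [_ _ dE] := d_betaE v (two _ x y).
    exact: etrans (esym dE) (congr1 (fun b => b _ v (two _ x y)) d_beta0).
  - apply/cocycle_identity.
    have [_ dE _] := d_betaE v (two _ x y).
    exact: etrans (esym dE) (congr1 (fun b => b _ v (two _ x y)) d_beta0).
  - apply/cocycle_identity.
    have [dE _ _] := d_betaE v (two _ x y).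
    exact: etrans (esym dE) (congr1 (fun b => b _ v (two _ x y)) d_beta0).
  - apply/eqP; rewrite -subr_eq0; apply/eqP.
    have /= <- := d_gammaE (two _ v w).
    exact: (congr1 (@^~ (two _ v w)) d_gamma0).
congr (_, _, _).
- by apply/funext => x; rewrite d_alphaE; apply/cocycle_identity.
- apply/funext => i; apply/funext => v; apply/funext => y.
  have [d0 d1 d2] := d_betaE v y.
  case: (ord3_cases i) => ->; rewrite ?d0 ?d1 ?d2; exact/cocycle_identity.
- by apply/funext => v; rewrite d_gammaE rop1 subrr.
Qed.


Lemma inf_deformationP (B : rRB_data g V) :
  inf_deformation A B <->
  bilinear_data B /\ cocycles A 2 (deformation_cochain B).
Proof.
have [[_ mu_id] [_ _ ll_id lr_id rr_id] [_ rop_id]] := A_rRB.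
split=> [[brkB lactB ractB ropB] [[_ mu_t] [_ _ ll_t lr_t rr_t] [_ rop_t]] |].
  have B_lin : bilinear_data B by [].
  split=> //; split; first exact: deformation_cochain_multilinear.
  apply/(d_rRB_deformation_eq0 B_lin); split.
  (* The bilinearity proof supplied fixes the outermost operation on the left of the identity: the
     bracket, then [lact] twice, then [ract]. *)
  - by apply/(dual_leibniz_identity brkA).
  - exact/(dual_leibniz_identity lactA).
  - exact/(dual_leibniz_identity lactA).
  - exact/(dual_leibniz_identity ractA).
  - exact/(dual_rota_baxter_identity brkA).
case=> B_lin [_ /(d_rRB_deformation_eq0 B_lin)].
have [brkB lactB ractB ropB] := B_lin.
case=> mu1 ll1 lr1 rr1 rop1; split=> //; split.
- split; first exact: dual_ext2_bilinear.
  exact/(dual_leibniz_identity brkA).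
- split; try exact: dual_ext2_bilinear.
  + exact/(dual_leibniz_identity lactA).
  + exact/(dual_leibniz_identity lactA).
  + exact/(dual_leibniz_identity ractA).
- split; first exact: dual_ext1_linear.
  exact/(dual_rota_baxter_identity brkA).
Qed.

(** * Coboundaries, their cosets, and equivalence of deformations *)

Lemma coboundaries2P (c : precochain g V 2) :
  coboundaries A 2 c <->
  exists phi psi, [/\ linear phi, linear psi
                   & c = deformation_cochain (coboundary_data phi psi)].
Proof.
split=> [[b /cochains1_linear[phi [psi [phiL psiL ->]]] <-]|].
  by exists phi, psi; split=> //; rewrite d_rRB_linear_cochain.
move=> [phi [psi [phiL psiL ->]]]; exists (linear_cochain phi psi).
  exact: linear_cochain_multilinear.
exact: d_rRB_linear_cochain.
Qed.

Lemma coboundaries2_0 : coboundaries A 2 0.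
Proof.
have lin0 (W : lmodType k) : linear (fun _ : W => 0 : W).
  by move=> a x y; rewrite scaler0 addr0.
apply/coboundaries2P; exists (fun=> 0), (fun=> 0); split=> //.
congr (_, _, _).
- by apply/funext => x /=; rewrite !zeros subr0 addr0.
- apply/funext => i; apply/funext => v; apply/funext => y /=.
  by case: ifP => _; rewrite !zeros subr0 addr0.
- by apply/funext => v /=; rewrite !zeros subr0.
Qed.

(** [coboundary_data] is additive in the pair, so the differences of the witnesses work; with
    [coboundaries2_0] the coboundaries form a subgroup. *)
Lemma coboundaries2_sub (c c' : precochain g V 2) :
  coboundaries A 2 c -> coboundaries A 2 c' -> coboundaries A 2 (c - c').
Proof.
move=> /coboundaries2P[phi [psi [phiL psiL ->]]].
move=> /coboundaries2P[phi' [psi' [phi'L psi'L ->]]].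
apply/coboundaries2P.
exists (fun x => phi x - phi' x), (fun v => psi v - psi' v).
split; [exact: linear_sub | exact: linear_sub |].
have subE (M : zmodType) (a b d a' b' d' : M) :
    (a + b - d) - (a' + b' - d') = (a - a') + (b - b') - (d - d').
  by rewrite !opprD [LHS](AC (3*3) (((1*4)*(2*5))*(3*6))).
congr (_, _, _).
- apply/funext => x /=.
  by rewrite (bilinear_Br brkA) (bilinear_Bl brkA) -subE.
- apply/funext => i; apply/funext => v; apply/funext => y /=.
  case: (ord2_cases i) => -> /=.
    by rewrite (bilinear_Br ractA) (bilinear_Bl ractA) -subE.
  by rewrite (bilinear_Br lactA) (bilinear_Bl lactA) -subE.
- apply/funext => v; by rewrite /= (linear_fB ropA) !opprD addrACA.
Qed.

Lemma cohomology_class2_eq (c c' : precochain g V 2) :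
  cohomology_class A 2 c = cohomology_class A 2 c' <->
  coboundaries A 2 (c - c').
Proof.
split=> [eq_cc' | cob].
  have : cohomology_class A 2 c c.
    by exists 0; rewrite ?addr0 //; apply: coboundaries2_0.
  by rewrite eq_cc' => -[b cob_b <-]; rewrite addrAC subrr add0r.
have cobN b : coboundaries A 2 b -> coboundaries A 2 (- b).
  by move=> cob_b; rewrite -sub0r; apply: coboundaries2_sub coboundaries2_0 _.
apply/seteqP; split=> _ [b cob_b <-].
  (* The witness is c - c' + b, written with a double negation because the available closure is
     under subtraction. *)
  exists (c - c' - - b); last by rewrite opprK addrA (addrC c') subrK.
  by apply: coboundaries2_sub => //; apply: cobN.
exists (b - (c - c')); first exact: coboundaries2_sub.
by rewrite opprB addrC addrA subrK addrC.
Qed.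

(** Equality of cosets being an equivalence relation, reflexivity, symmetry and transitivity of
    [equiv_deformation] come for free. *)
Lemma equiv_deformationP (B B' : rRB_data g V) :
  equiv_deformation A B B' <->
  cohomology_class A 2 (deformation_cochain B)
  = cohomology_class A 2 (deformation_cochain B').
Proof.
rewrite cohomology_class2_eq; split.
  move=> [Phi [Psi [[[[PhiL PsiL] mor] _ _] Phi_aug Psi_aug]]].
  have [phi phiL PhiE] := dual_endo_expand PhiL Phi_aug.
  have [psi psiL PsiE] := dual_endo_expand PsiL Psi_aug.
  move: mor; rewrite PhiE PsiE => -[/(dual_morphism2 _ _ _ _ _ brkA) brkE].
  move=> /(dual_morphism2 _ _ _ _ _ lactA) lactE.
  move=> /(dual_morphism2 _ _ _ _ _ ractA) ractE.
  move=> /(dual_morphism1 _ _ _ _ ropA) ropE.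
  apply/coboundaries2P; exists phi, psi; split=> //.
  apply/eqP; rewrite subr_eq; apply/eqP; congr (_, _, _).
  - by apply/funext => x /=; rewrite brkE addrC.
  - apply/funext => i; apply/funext => v; apply/funext => y /=.
    by case: (ord2_cases i) => -> /=; rewrite (ractE, lactE) addrC.
  - by apply/funext => v /=; rewrite ropE addrC.
move=> /coboundaries2P[phi [psi [phiL psiL /eqP]]].
rewrite subr_eq => /eqP BE; exists (dual_ext1 id phi), (dual_ext1 id psi).
have idL (M : lmodType k) : linear (@id M) by [].
split=> //; split; try exact: dual_ext1_id_bij.
split; first by split; apply: dual_ext1_linear.
split.
(* Each component of the morphism condition is [BE] evaluated at a suitable tuple. *)
- apply/(dual_morphism2 _ _ _ _ _ brkA) => x y; rewrite addrC.
  pose z (i : 'I_2) := if i == ord0 then x else y.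
  exact: (congr1 (fun c => c.1.1 z) BE).
- apply/(dual_morphism2 _ _ _ _ _ lactA) => x v; rewrite addrC.
  exact: (congr1 (fun c => c.1.2 ord_max v (fun=> x)) BE).
- apply/(dual_morphism2 _ _ _ _ _ ractA) => v x; rewrite addrC.
  exact: (congr1 (fun c => c.1.2 ord0 v (fun=> x)) BE).
- apply/(dual_morphism1 _ _ _ _ ropA) => v; rewrite addrC.
  exact: (congr1 (fun c => c.2 (fun=> v)) BE).
Qed.

End SecondCohomology.

(** * The bijection between deformation classes and cohomology classes *)

Theorem theorem6p5 (k : fieldType) (char_k : [pchar k] =i pred0)
    (g V : lmodType k) (A : rRB_data g V) (hA : rRB_leibniz A) :
  exists F : set (rRB_data g V) -> set (precochain g V 2),
    set_bij (deformation_classes A) (cohomology A 2) F /\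
    (forall B : rRB_data g V, inf_deformation A B ->
       F (deformation_class A B)
       = cohomology_class A 2 (deformation_cochain B)).
Proof.
(* The union avoids choosing a representative: all members of a deformation class have the same
   coset, so the union is that coset. *)
pose F (S : set (rRB_data g V)) : set (precochain g V 2) :=
  (\bigcup_(B in S) cohomology_class A 2 (deformation_cochain B))%classic.
have FE B : inf_deformation A B ->
    F (deformation_class A B) = cohomology_class A 2 (deformation_cochain B).
  move=> B_def; apply/seteqP; split=> [c [B' [_]] | c Bc].
    by move=> /(equiv_deformationP hA) ->.
  by exists B => //; split=> //; apply/(equiv_deformationP hA).
exists F; split=> //; split.
- move=> _ [B B_def <-]; rewrite FE //; exists (deformation_cochain B) => //.
  by have [] := (inf_deformationP hA B).1 B_def.
- move=> S S' /set_mem[B B_def <-] /set_mem[B' B'_def <-].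
  rewrite !FE // => eq_BB'; apply/seteqP; split=> C;
    by move=> [C_def /(equiv_deformationP hA) eq_C]; split=> //;
      apply/(equiv_deformationP hA); rewrite -eq_C eq_BB'.
- move=> _ [c c_cocycle <-].
  (* Surjectivity: a cocycle is the cochain of some quadruple, which is then a deformation by
     [inf_deformationP]. *)
  have [B B_lin cE] := cochains2_deformation c_cocycle.1.
  have B_def : inf_deformation A B.
    by apply/(inf_deformationP hA); rewrite -cE.
  by exists (deformation_class A B); [exists B | rewrite FE // -cE].
Qed.
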